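(* Let $M$ be a normal $n$-multimagic square of order $m$ (with $n\ge 1$) and let $p$ be a prime. If $v_p(m)=e\ge 1$, then $n\le p^{e+1}-2$.
   Context: For a prime $p$ and a positive integer $m$, $v_p(m)$ is the largest nonnegative integer $e$ such that $p^e$ divides $m$. An $m\times m$ matrix of natural numbers is a magic square (of order $m$) if the sums of the elements in each row, in each column and in each of the two main diagonals (entries $(i,i)$, and entries $(i,m+1-i)$) are all equal to the same number. For a matrix $M$, $M^{*d}$ denotes the matrix obtained by raising each entry to the $d$-th power. $M$ is an $n$-multimagic square if $M^{*d}$ is a magic square for every $d=1,2,\dots,n$. An $m\times m$ matrix is normal if its entries are the integers $1,2,\dots,m^2$, each occurring exactly once. *)

(* Defs.v *)
From mathcomp Require Import all_boot all_order all_algebra.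
Set Implicit Arguments.
Unset Strict Implicit.
Unset Printing Implicit Defensive.

(* [rev_ord i] is [m - 1 - i], i.e. the column m + 1 - i in 1-based indexing. *)
Definition magic_square (m : nat) (A : 'M[nat]_m) : Prop :=
  exists s : nat,
    [/\ forall i : 'I_m, \sum_(j < m) A i j = s,
        forall j : 'I_m, \sum_(i < m) A i j = s,
        \sum_(i < m) A i i = s
      & \sum_(i < m) A i (rev_ord i) = s].

Definition mx_entry_pow (m : nat) (A : 'M[nat]_m) (d : nat) : 'M[nat]_m :=
  map_mx (fun x : nat => x ^ d) A.

Definition multimagic_square (n m : nat) (A : 'M[nat]_m) : Prop :=
  forall d : nat, 1 <= d <= n -> magic_square (mx_entry_pow A d).

Definition normal_matrix (m : nat) (A : 'M[nat]_m) : Prop :=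
  perm_eq [seq A ij.1 ij.2 | ij : 'I_m * 'I_m] (iota 1 (m ^ 2)).

(* Main.v *)
Require Import Defs.
From mathcomp Require Import all_boot all_order all_algebra.

(** If f is an integer-valued polynomial of degree at most n, the sum of f over
    a row of M is an integer that does not depend on the row, so m divides the
    sum of f(x) over 1 <= x <= m^2.  For f(x) = 'C(x, q - 1) with q = p^(e+1),
    this sum is 'C(m^2 + 1, q), whose p-adic valuation is
    2e - (e + 1) = e - 1 < v_p(m).  Hence n < q - 1. *)

(** The factor [x ^ c] is there for the induction on [d]: [x ^_ d.+1 = x ^_ d * (x - d)] trades one
    falling step for one more power of [x]. *)
Lemma row_sum_exp_ffact {n m : nat} {M : 'M[nat]_m} (c d : nat) :
  multimagic_square n M -> c + d <= n ->
  exists s, forall i, \sum_(j < m) M i j ^ c * M i j ^_ d = s.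
Proof.
move=> hM; elim: d c => [|d IHd] c.
  rewrite addn0 => le_cn; case: c le_cn => [|c] le_cn.
    exists m => i; rewrite -[RHS]card_ord -sum1_card.
    by apply: eq_bigr => j _; rewrite expn0 ffactn0.
  have [s [row_s _ _ _]] := hM c.+1 le_cn.
  exists s => i; rewrite -(row_s i).
  by apply: eq_bigr => j _; rewrite ffactn0 muln1 mxE.
move=> le_n.
have [s row_s] := IHd c.+1 (leq_trans (eq_leq (addSnnS c d)) le_n).
have [t row_t] := IHd c (leq_trans (leq_add (leqnn c) (leqnSn d)) le_n).
exists (s - d * t) => i.
rewrite -(row_s i) -(row_t i) big_distrr /=.
(* Truncated subtraction is harmless: an entry below [d] has [x ^_ d = 0]. *)
apply/eqP; rewrite -(eqn_add2r (\sum_(j < m) d * (M i j ^ c * M i j ^_ d))).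
rewrite subnK -?big_split /=; last first.
  apply: leq_sum => j _; rewrite expnS -mulnA.
  have [le_dx|lt_xd] := leqP d (M i j); first by rewrite leq_mul2r le_dx orbT.
  by rewrite ffact_small // !muln0.
apply/eqP/eq_bigr => j _; rewrite ffactnSr expnS.
have [le_dx|lt_xd] := leqP d (M i j); last by rewrite ffact_small // !muln0.
by rewrite mulnA [X in X + _]mulnC -mulnDl subnK // mulnA.
Qed.

Lemma row_sum_bin {n m : nat} {M : 'M[nat]_m} (d : nat) :
  multimagic_square n M -> d <= n ->
  exists s, forall i, \sum_(j < m) 'C(M i j, d) = s.
Proof.
move=> hM le_dn; have [s row_s] := row_sum_exp_ffact 0 _ hM le_dn.
exists (s %/ d`!) => i; rewrite -(row_s i).
under [in RHS]eq_bigr do rewrite expn0 mul1n -bin_ffact.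
by rewrite -big_distrl /= mulnK ?fact_gt0.
Qed.

(** Hockey-stick identity; the positive lower index [d.+1] lets the sum start at 1. *)
Lemma sum_bin_iota (N d : nat) :
  \sum_(x <- iota 1 N) 'C(x, d.+1) = 'C(N.+1, d.+2).
Proof.
elim: N => [|N IHN]; first by rewrite big_nil bin_small.
by rewrite -[in iota 1 _](addn1 N) iotaD big_cat /= big_seq1 IHN add1n [RHS]binS.
Qed.

Lemma dvdn_order_bin {n m : nat} {M : 'M[nat]_m} (d : nat) :
  normal_matrix M -> multimagic_square n M -> d < n ->
  m %| 'C((m ^ 2).+1, d.+2).
Proof.
move=> normM hM lt_dn; have [s row_s] := row_sum_bin d.+1 hM lt_dn.
rewrite -sum_bin_iota -(perm_big _ normM) /= big_map big_enum /=.
rewrite -(pair_bigA _ (fun i j => 'C(M i j, d.+1))) /=.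
by rewrite (eq_bigr (fun=> s)) // sum_nat_const card_ord dvdn_mulr.
Qed.

(* [p] divides ['C(N, j)] for [0 < j < p ^ a], so by Pascal's rule
   ['C(N - 1, j)] and [- 'C(N - 1, j - 1)] agree modulo [p]. *)
Lemma prime_ndvd_bin_pred (p a N j : nat) :
  prime p -> 0 < N -> p ^ a %| N -> j < p ^ a -> ~~ (p %| 'C(N.-1, j)).
Proof.
move=> p_pr N_gt0 paN; elim: j => [|j IHj] lt_j.
  by rewrite bin0 dvdn1 neq_ltn prime_gt1 ?orbT.
have p_bin : p %| 'C(N, j.+1).
  (* Otherwise [j.+1 * 'C(N, j.+1) = N * 'C(N.-1, j)] forces [p ^ a] to divide [j.+1]. *)
  apply: contraLR lt_j => p_ndvd; rewrite -leqNgt dvdn_leq //.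
  rewrite -(@Gauss_dvdl _ _ 'C(N, j.+1)) ?coprimeXl ?prime_coprime //.
  by rewrite -mul_bin_diag dvdn_mulr.
move: p_bin; rewrite -{1}(prednK N_gt0) binS => p_bin.
apply: contra (IHj (ltnW lt_j)) => p_dvd.
by rewrite -(dvdn_addr _ p_dvd).
Qed.

Lemma prime_pow_ndvd_bin_sqr (p e m : nat) :
  prime p -> logn p m = e -> 0 < e -> ~~ (p ^ e %| 'C((m ^ 2).+1, p ^ e.+1)).
Proof.
move=> p_pr logm e_gt0; set q := p ^ e.+1.
have m_gt0 : 0 < m by case: m logm => // log0; rewrite -log0 logn0 in e_gt0.
have N_gt0 : 0 < m ^ 2 by rewrite expn_gt0 m_gt0.
have q_gt0 : 0 < q by rewrite expn_gt0 prime_gt0.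
have logN : logn p (m ^ 2) = e + e by rewrite lognX logm mul2n addnn.
have qN : q %| m ^ 2.
  by rewrite pfactor_dvdn // logN -addn1 leq_add2l.
have p_ndvd : ~~ (p %| 'C((m ^ 2).-1, q.-1)).
  by apply: prime_ndvd_bin_pred qN _; rewrite ?prednK.
have bin_pred_gt0 : 0 < 'C((m ^ 2).-1, q.-1).
  by rewrite lt0n; apply: contraNneq p_ndvd => ->; rewrite dvdn0.
apply/negP => pe_dvd.
have pN : p %| m ^ 2 by apply: dvdn_trans qN; rewrite /q expnS dvdn_mulr.
(* The two binomials differ by the factors [m ^ 2 + 1], prime to [p], and [m ^ 2 + 1 - q]. *)
have pe_dvd' : p ^ e %| 'C(m ^ 2, q).
  rewrite -(@Gauss_dvdr _ (m ^ 2).+1); last first.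
    rewrite coprimeXl // prime_coprime // -addn1 dvdn_addr // dvdn1.
    by rewrite neq_ltn prime_gt1 ?orbT.
  by rewrite mul_bin_down dvdn_mull.
(* The product equals [q * 'C(m ^ 2, q)], yet its [p]-adic valuation is only [e + e]. *)
have : p ^ (e.+1 + e) %| m ^ 2 * 'C((m ^ 2).-1, q.-1).
  by rewrite mul_bin_diag prednK // expnD dvdn_mul.
rewrite pfactor_dvdn ?[0 < _ * _]muln_gt0 ?m_gt0 ?bin_pred_gt0 // lognM // logN.
by rewrite logn_coprime ?prime_coprime // addn0 addSn ltnn.
Qed.

Theorem theorem5p5 (m n p e : nat) (M : 'M[nat]_m)
    (hn : 1 <= n) (hnormal : normal_matrix M) (hmulti : multimagic_square n M)
    (hp : prime p) (he : logn p m = e) (he1 : 1 <= e) :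
  n <= p ^ e.+1 - 2.
Proof.
rewrite leqNgt; apply/negP => lt_n.
(* Ensures that [p ^ e.+1 - 2] is not truncated, so adding 2 gives back [p ^ e.+1]. *)
have q_gt1 : 1 < p ^ e.+1 by rewrite -(exp1n e.+1) ltn_exp2r ?prime_gt1.
have := dvdn_order_bin _ hnormal hmulti lt_n; rewrite -[X in 'C(_, X)]addn2 subnK // => m_dvd.
have /negP[] := prime_pow_ndvd_bin_sqr _ _ _ hp he he1; apply: dvdn_trans m_dvd.
by rewrite -he pfactor_dvdnn.
Qed.
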